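(* Let $N\geq 2$ and let $\rho$ be the unique positive real root of $X^N-X^{N-1}-\cdots-X-1$. Let $x\neq 0$ be a $\rho$-integer having a representation of degree $n\geq 0$. Then $x$ has a representation in normal form of degree $n$ or of degree $n+1$.
   Context: A non-negative real number $x$ is a $\rho$-integer if $x=\sum_{i=0}^{n}c_i\rho^{n-i}$ for some $n\in\mathbb N_0$ and coefficients $c_i\in\{0,1\}$; such an expression is a representation of $x$. If $x\neq0$ and $r$ is the smallest index with $c_r=1$, the representation has degree $n-r$ (i.e. the degree is the largest exponent of $\rho$ occurring with coefficient $1$). A representation $x=\rho^n+\sum_{i=1}^n c_i\rho^{n-i}$ (with $c_i\in\{0,1\}$) is in normal form if, setting $c_0=1$ and $c_k=0$ for $k>n$, one has $\prod_{k=j}^{j+N-1}c_k=0$ for all $j\geq 0$; i.e. every block of $N$ consecutive coefficients contains a zero. Such a normal form representation has degree $n$. *)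

(* Defs.v *)
From HB Require Import structures.
From mathcomp Require Export all_boot all_order all_algebra.
From mathcomp Require Export reals.

Set Implicit Arguments.
Unset Strict Implicit.
Unset Printing Implicit Defensive.

Import Order.TTheory GRing.Theory Num.Theory.
Local Open Scope ring_scope.

(* The coefficient string c_0 ... c_n of a representation is a tuple
   c : n.+1.-tuple bool.  The default value of [nth] is the convention
   c_k = 0 for k > n. *)
Definition coefn (n : nat) (c : n.+1.-tuple bool) (k : nat) : nat :=
  nat_of_bool (nth false c k).

Definition represents (R : realType) (rho x : R) (n : nat)
    (c : n.+1.-tuple bool) : Prop :=
  x = \sum_(i < n.+1) (coefn c i)%:R * rho ^+ (n - i).

Definition rho_integer (R : realType) (rho x : R) : Prop :=
  0 <= x /\ exists (n : nat) (c : n.+1.-tuple bool), represents rho x c.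

(* [index true c] is the smallest r with c_r = 1. *)
Definition has_degree (n : nat) (c : n.+1.-tuple bool) (d : nat) : Prop :=
  true \in c /\ d = (n - index true c)%N.

Definition normal_form (N n : nat) (c : n.+1.-tuple bool) : Prop :=
  coefn c 0 = 1%N /\
  forall j : nat, (\prod_(j <= k < j + N) coefn c k)%N = 0%N.

Definition has_rep_of_degree (R : realType) (rho x : R) (d : nat) : Prop :=
  exists (n : nat) (c : n.+1.-tuple bool), represents rho x c /\ has_degree c d.

Definition has_normal_form_of_degree (R : realType) (N : nat) (rho x : R)
    (d : nat) : Prop :=
  exists (n : nat) (c : n.+1.-tuple bool),
    [/\ represents rho x c, normal_form N c & has_degree c d].

(* Main.v *)
Require Import Defs.
From mathcomp Require Import all_boot all_order all_algebra.
From mathcomp Require Import reals.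
From mathcomp Require Import zify.

Set Implicit Arguments.
Unset Strict Implicit.
Unset Printing Implicit Defensive.

Import Order.TTheory GRing.Theory Num.Theory.
Local Open Scope ring_scope.

(** View a representation as a finite set [A] of exponents.  Since
    [rho^(k+N) = rho^k + ... + rho^(k+N-1)], a block of [N] consecutive exponents
    below a missing one can be replaced by the latter, which lowers the
    cardinality because [N >= 2].  Among the exponent sets of [x] bounded by
    [n+1] and containing [n] or [n+1], one of minimal cardinality is thus a normal
    form: a topmost block of [N] exponents would either allow a carry or end at
    [n+1]; the latter gives [x >= rho^(n+2)], whereas
    [x <= 1 + ... + rho^n < rho^(n+2)] because [rho^2 >= rho + 1]. *)

Section CarryRule.
Variables (R : realType) (N : nat) (rho : R).
Hypotheses (N_ge2 : (2 <= N)%N) (rho_gt0 : 0 < rho).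
Hypothesis rho_root : root ('X^N - \sum_(i < N) 'X^i) rho.

Lemma rho_exprN : rho ^+ N = \sum_(i < N) rho ^+ i.
Proof.
move: rho_root; rewrite /root hornerD hornerN hornerXn horner_sum subr_eq0.
by move/eqP->; apply: eq_bigr => i _; rewrite hornerXn.
Qed.

(** The two top terms of [rho_exprN] give [rho ^+ (N - 2) + rho ^+ (N - 1) <= rho ^+ N]; divide by
    [rho ^+ (N - 2)]. *)
Lemma rho_sqr_ge : rho + 1 <= rho ^+ 2.
Proof.
have := rho_exprN; case: N N_ge2 => [|[|M]] // _.
rewrite !big_ord_recr /= => E.
have : rho ^+ M + rho ^+ M.+1 <= rho ^+ M.+2.
  rewrite [leRHS]E -addrA lerDr sumr_ge0 // => i _.
  by rewrite exprn_ge0 // ltW.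
have -> : rho ^+ M.+2 = rho ^+ M * rho ^+ 2 by rewrite -exprD addn2.
by rewrite exprSr -{1}[rho ^+ M]mulr1 -mulrDr ler_pM2l ?exprn_gt0 // addrC.
Qed.

Lemma sum_expr_lt m : \sum_(i < m) rho ^+ i < rho ^+ m.+1.
Proof.
elim: m => [|m IHm]; first by rewrite big_ord0 expr1.
rewrite big_ord_recr /=; apply: (@lt_le_trans _ _ (rho ^+ m.+1 + rho ^+ m)).
  by rewrite ltrD2r.
have -> : rho ^+ m.+2 = rho ^+ m * rho ^+ 2 by rewrite -exprD addn2.
rewrite exprSr -{2}[rho ^+ m]mulr1 -mulrDr ler_pM2l ?exprn_gt0 //.
exact: rho_sqr_ge.
Qed.

Definition value m (A : {set 'I_m}) : R := \sum_(i in A) rho ^+ i.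

Definition block m k : {set 'I_m} := [set i : 'I_m | (k <= i < k + N)%N].

(** Kept general in [F] so that it yields both the cardinality of a block ([F] constantly 1) and its
    value ([F] the powers of [rho]). *)
Lemma sum_block (V : nmodType) (F : nat -> V) m k : (k + N <= m)%N ->
  \sum_(i in block m k) F i = \sum_(i < N) F (k + i)%N.
Proof.
move=> le_m; transitivity (\sum_(k <= i < k + N) F i).
  rewrite (big_nat_widenl _ 0) // (big_nat_widen 0 _ m) // big_mkord.
  by apply: eq_bigl => i; rewrite inE /=.
by rewrite -{1}[k]add0n big_addn addKn big_mkord; apply: eq_bigr => i _; rewrite addnC.
Qed.

Lemma card_block m k : (k + N <= m)%N -> #|block m k| = N.
Proof.
by move=> le_m; rewrite -sum1_card (sum_block (fun=> 1%N)) // sum1_card card_ord.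
Qed.

Lemma value_block m k : (k + N <= m)%N -> value (block m k) = rho ^+ (k + N).
Proof.
move=> le_m; rewrite /value (sum_block (GRing.exp rho)) // exprD rho_exprN mulr_sumr.
by apply: eq_bigr => i _; rewrite exprD.
Qed.

Lemma value_le_sub m (A B : {set 'I_m}) : B \subset A -> value B <= value A.
Proof.
move=> sBA; rewrite /value [leRHS](big_setID B) /= (setIidPr sBA) lerDl.
by rewrite sumr_ge0 // => i _; rewrite exprn_ge0 // ltW.
Qed.

Lemma value_carry {m k} {A : {set 'I_m}} {t : 'I_m} :
  t = (k + N)%N :> nat -> block m k \subset A -> t \notin A ->
  value (t |: (A :\: block m k)) = value A.
Proof.
move=> def_t sBA tA; rewrite /value big_setU1 /=; last first.
  by rewrite inE negb_and tA orbT.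
rewrite [in RHS](big_setID (block m k)) /= (setIidPr sBA) def_t.
by rewrite -[X in _ = X + _]/(value _) value_block // -def_t ltnW.
Qed.

(** The carry removes [N >= 2] exponents and adds at most one. *)
Lemma card_carry {m k} {A : {set 'I_m}} {t : 'I_m} :
  t = (k + N)%N :> nat -> block m k \subset A ->
  (#|t |: (A :\: block m k)| < #|A|)%N.
Proof.
move=> def_t sBA; have le_m : (k + N <= m)%N by rewrite -def_t ltnW.
have := subset_leq_card sBA; rewrite cardsU1 cardsD (setIidPr sBA).
by rewrite card_block //; move: #|A| N_ge2 => a; case: (_ \notin _) => /=; lia.
Qed.

Lemma exists_blockfree n (A0 : {set 'I_n.+2}) :
    value A0 < rho ^+ n.+2 -> (ord_max \in A0) || (inord n \in A0) ->
  exists A : {set 'I_n.+2}, [/\ value A = value A0,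
    (ord_max \in A) || (inord n \in A) &
    forall k, (k + N <= n.+2)%N -> ~~ (block n.+2 k \subset A)].
Proof.
move=> ltA0 topA0.
pose P (A : {set 'I_n.+2}) :=
  (value A == value A0) && ((ord_max \in A) || (inord n \in A)).
have P0 : P A0 by rewrite /P eqxx.
have [A /andP[/eqP vA topA] minA] := arg_minnP (fun A : {set _} => #|A|) P0.
exists A; split=> // k.
(* Induction on the distance from the end of the block to [n.+2]: blocks are excluded from the top
   downwards. *)
have [r] := ubnP (n.+2 - (k + N)); elim: r k => // r IHr k lt_r le_k.
apply/negP => sBA; move: le_k; rewrite leq_eqVlt => /predU1P[def_k | lt_k].
  have := value_le_sub sBA; rewrite value_block ?def_k //.
  by rewrite vA leNgt ltA0.
pose t : 'I_n.+2 := Ordinal lt_k.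
have [tA | tA] := boolP (t \in A).
  (* If [t] is in [A], the block shifted up by one also lies in [A], against the induction
     hypothesis. *)
  have /negP[] : ~~ (block n.+2 k.+1 \subset A) by apply: IHr; lia.
  apply/subsetP => i; rewrite inE => /andP[lt_ki].
  rewrite addSn ltnS leq_eqVlt => /predU1P[def_i | lt_i].
    by rewrite (_ : i = t) //; apply: val_inj.
  by apply: (subsetP sBA); rewrite inE ltnW.
have /minA : P (t |: (A :\: block n.+2 k)).
  rewrite /P (value_carry (t := t) (erefl _) sBA tA) vA eqxx /= !inE /=.
  rewrite -!val_eqE /= inordK //.
  (* The carry keeps [n] or [n.+1] in the set: the block lies below [t <= n.+1], so [n.+1] is never
     removed, and [n] is removed only when [t = n.+1] is added. *)
  case/orP: topA => top; rewrite top andbT.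
    by rewrite (_ : ~~ _ = true) ?orbT //; apply/negP; lia.
  have [/=|ne_t] := eqVneq n (k + N)%N; first by rewrite orbT.
  have [//|ne_t'] := eqVneq n.+1 (k + N)%N.
  by rewrite [X in _ || X](_ : _ = true) ?orbT //; apply/negP; lia.
by rewrite leqNgt (card_carry (t := t)).
Qed.

End CarryRule.

Lemma representsE (R : realType) (rho x : R) n (c : n.+1.-tuple bool) :
  represents rho x c <-> x = \sum_(i < n.+1 | nth false c (n - i)) rho ^+ i.
Proof.
rewrite /represents (reindex_inj rev_ord_inj) [in X in _ <-> X]big_mkcond /=.
under eq_bigr => i _.
  have le_in : (i <= n)%N by rewrite -ltnS.
  rewrite subSS subKn // /coefn mulr_natl mulrb.
  over.
by [].
Qed.

(** The string may start with zeros, so [m] can exceed [n]. The ambient type ['I_n.+2] leaves room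
    for the exponent [n.+1], which a carry may create. *)
Lemma degree_exponent_set (R : realType) (rho x : R) n :
  has_rep_of_degree rho x n -> exists A : {set 'I_n.+2},
    [/\ x = value rho A, ord_max \notin A & inord n \in A].
Proof.
case=> m [c] [/representsE xE [c1 def_n]].
have lt_c : (index true c < m.+1)%N by move: c1; rewrite -index_mem size_tuple.
pose a e := nth false c (m - e).
(* The bound on [i] matters: if [m = n], the truncated [m - n.+1] is 0 and [a n.+1] would read the
   leading coefficient. *)
exists [set i : 'I_n.+2 | a i && (i < n.+1)%N]; split; last 2 first.
- by rewrite inE ltnn andbF.
- by rewrite inE inordK // ltnSn andbT /a def_n subKn // nth_index.
transitivity (\sum_(i < n.+1 | a i) rho ^+ i); last first.
  rewrite (big_ord_widen_cond n.+2) // /value.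
  by apply: eq_bigl => i; rewrite inE.
have le_nm : (n.+1 <= m.+1)%N by rewrite def_n ltnS leq_subr.
rewrite xE [RHS](big_ord_widen_cond m.+1 a (GRing.exp rho)) //.
apply: eq_bigl => i; rewrite -/(a i); case ai: (a i) => //=.
(* A coefficient 1 at an exponent [i > n] would have index [m - i], smaller than the first index of
   a 1. *)
apply/esym; rewrite ltnNge; apply/negP => lt_ni.
have := before_find (a := pred1 true) false (s := c) (i := m - i).
rewrite -/(index true c) /= -/(a i) ai => /(_ _)/negbT.
by move=> H; have: false by apply: H; have := ltn_ord i; lia.
Qed.

(** A window reaching past index [n] ends in a default coefficient 0, so only windows inside the
    string need checking. *)
Lemma normal_form_blockfree N n (c : n.+1.-tuple bool) :
    (0 < N)%N -> nth false c 0 ->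
    (forall j, (j + N <= n.+1)%N -> ~~ all (nth false c) (index_iota j (j + N))) ->
  normal_form N c.
Proof.
move=> N0 c0 free; split=> [|j]; first by rewrite /coefn c0.
suff /allPn[k kj ck] : ~~ all (nth false c) (index_iota j (j + N)).
  by rewrite (bigD1_seq k) ?iota_uniq //= /coefn (negbTE ck).
have [/free // | lt_n] := leqP (j + N) n.+1.
apply/allPn; exists (j + N).-1; first by rewrite mem_index_iota; lia.
by rewrite nth_default // size_tuple; lia.
Qed.

Theorem theorem3p8 (R : realType) (N : nat) (hN : (2 <= N)%N) (rho : R)
    (rho_gt0 : 0 < rho)
    (rho_root : root ('X^N - \sum_(i < N) 'X^i) rho)
    (x : R) (x_neq0 : x <> 0) (x_int : rho_integer rho x)
    (n : nat) (x_deg : has_rep_of_degree rho x n) :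
  has_normal_form_of_degree N rho x n \/
  has_normal_form_of_degree N rho x n.+1.
Proof.
have [A0 [xE topA0 nA0]] := degree_exponent_set x_deg.
have ltA0 : value rho A0 < rho ^+ n.+2.
  (* [A0] omits [n.+1], so its value is at most the sum of all powers up to [rho ^+ n]. *)
  apply: le_lt_trans (sum_expr_lt hN rho_gt0 rho_root n.+1).
  rewrite (big_ord_widen n.+2 (GRing.exp rho)) //.
  rewrite (eq_bigl (mem [set~ (ord_max : 'I_n.+2)])); last first.
    by move=> i; rewrite !inE -val_eqE /=; have := ltn_ord i; lia.
  by apply: (value_le_sub rho_gt0); rewrite subsetC sub1set inE.
have [|A [vA topA freeA]] := exists_blockfree hN rho_gt0 rho_root ltA0.
  by rewrite nA0 orbT.
(* [L] stands for the largest exponent in [A], which is [n.+1] or [n]; reading [A] downwards from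
   [L] gives a string with leading coefficient 1. *)
suff nf L : (L <= n.+1)%N -> inord L \in A -> (forall i, i \in A -> i <= L)%N ->
    has_normal_form_of_degree N rho x L.
  have [topA1 | topA1] := boolP (ord_max \in A).
    right; apply: nf => // [|i _]; last by rewrite -ltnS.
    by rewrite (_ : inord _ = ord_max) //; apply: val_inj; rewrite /= inordK.
  left; apply: nf => // [|i iA]; first by rewrite (negbTE topA1) in topA.
  have: i != ord_max by apply: contraNneq topA1 => <-.
  by rewrite -val_eqE /=; have := ltn_ord i; lia.
move=> leL LA maxL; pose c := [tuple inord (L - i) \in A | i < L.+1].
have cE i : (i <= L)%N -> nth false c i = (inord (L - i) \in A).
  rewrite -ltnS => ltiL.
  by rewrite (nth_map (Ordinal ltiL)) ?size_enum_ord // nth_enum_ord.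
exists L, c; split; last 1 first.
- have c0 : nth false c 0 = true by rewrite cE // subn0.
  split; first by rewrite -c0 mem_nth // size_tuple.
  have c00 : head false c = true by rewrite -nth0.
  by case: (tval c) c00 => //= b s ->; rewrite subn0.
- apply/representsE; rewrite xE -vA.
  rewrite (big_ord_widen_cond n.+2 (fun i => nth false c (L - i)) (GRing.exp rho)) //.
  rewrite /value; apply: eq_bigl => i; have [le_iL | lt_Li] := leqP i L.
    by rewrite ltnS le_iL cE ?leq_subr // subKn // inord_val andbT.
  by rewrite ltnNge lt_Li andbF; apply/negP => /maxL; rewrite leqNgt lt_Li.
apply: normal_form_blockfree => [||j le_j]; first exact: ltnW.
  by rewrite cE // subn0.
(* The indices from [j] to [j + N - 1] carry the exponents from [L - j] down to [L.+1 - (j + N)],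
   which form a block. *)
apply: contra (freeA (L.+1 - (j + N))%N _) => [/allP all_c|]; last by lia.
apply/subsetP => i; rewrite inE => /andP[le_i lt_i].
have /all_c : (L - i)%N \in index_iota j (j + N) by rewrite mem_index_iota; lia.
by rewrite cE ?leq_subr // subKn ?inord_val //; lia.
Qed.
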